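(* Let $g\in C^1(\mathbb{R})$ and let $h\in(1/2,1]$ be such that $g'$ is Hölder continuous of order $h$ with a global Hölder constant, i.e. there is a constant $C$ with $|g'(x)-g'(y)|\le C|x-y|^h$ for all $x,y\in\mathbb{R}$. Let $p$ be a probability measure on $\mathbb{R}$ with a finite absolute moment of order $2+2h$, and let $x_1,x_2,\ldots$ be independent random variables with law $p$. Consider the functional $T(m)=g(\overline{m})$, where $\overline{m}=\int x\,m(dx)$. Let $v_{jack}$ and $v_{ijack}$ be the jackknife and infinitesimal jackknife variance estimators for $T$ computed from $x_1,\ldots,x_n$. Then, as $n\to\infty$, $$v_{jack}-v_{ijack}=\mathrm{O}_{\mathrm{p}}\big(n^{-h}\big).$$
   Context: For data $x_1,\ldots,x_n$ ($n\ge 2$), let $\epsilon_n=\frac1n\sum_{i=1}^n\delta(x_i)$ be the empirical measure and $\epsilon_{ni}=\frac{1}{n-1}\sum_{j\ne i}\delta(x_j)$ the leave-one-out empirical measure, where $\delta(x)$ is the point mass at $x$. The jackknife pseudovalues of a functional $T$ are $Q_{ni}=nT(\epsilon_n)-(n-1)T(\epsilon_{ni})$, $i=1,\ldots,n$. With $\overline{Q_n}=\frac1n\sum_{j=1}^n Q_{nj}$, the jackknife variance estimator is $$v_{jack}=\frac{1}{n-1}\sum_{i=1}^n\big(Q_{ni}-\overline{Q_n}\big)^2.$$ The functional $T(m)=g(\overline{m})$ is defined for all finite signed measures $m$ on $\mathbb{R}$ with finite first moment. Its functional derivative at $m$ is $\partial T_m(q)=g'(\overline{m})\,\overline{q}$,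 and its influence function at a probability measure $m$ is $\phi_m(x)=\partial T_m(\delta(x)-m)=g'(\overline{m})(x-\overline{m})$. The infinitesimal jackknife variance estimator is $$v_{ijack}=\mathbb{E}_{\epsilon_n}\phi_{\epsilon_n}^2=\frac1n\sum_{i=1}^n g'(\overline{\epsilon_n})^2\,(x_i-\overline{\epsilon_n})^2,\qquad \overline{\epsilon_n}=\frac1n\sum_{i=1}^n x_i.$$ The notation $X_n=\mathrm{O}_{\mathrm{p}}(n^{-h})$ means that $n^hX_n$ is bounded in probability: for every $\eta>0$ there exist $M$ and $N$ such that $\Pr(|X_n|>Mn^{-h})<\eta$ for all $n\ge N$. *)

(* Defs.v *)
From HB Require Import structures.
From mathcomp Require Import all_boot all_order all_algebra finmap.
From mathcomp Require Import all_classical all_reals all_analysis.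

Set Implicit Arguments.
Unset Strict Implicit.
Unset Printing Implicit Defensive.

Import Order.TTheory GRing.Theory Num.Theory.
Import numFieldNormedType.Exports.

Local Open Scope classical_set_scope.
Local Open Scope ring_scope.

Notation signed_measure R := ({charge set (measurableTypeR R) -> \bar R}%R).

Section mean_of_signed_measure.
Context {R : realType} (m : signed_measure R).

Definition hahn_pos : set (measurableTypeR R) :=
  projT1 (cid (Hahn_decomposition m)).

Definition hahn_neg : set (measurableTypeR R) :=
  projT1 (cid (projT2 (cid (Hahn_decomposition m)))).

Lemma hahn_posneg : hahn_decomposition m hahn_pos hahn_neg.
Proof. exact: projT2 (cid (projT2 (cid (Hahn_decomposition m)))). Qed.

(* The value is independent of the chosen Hahn decomposition, and is only
   meaningful when m has a finite first moment. *)
Definition mean : R :=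
  \int[jordan_pos hahn_posneg]_x x - \int[jordan_neg hahn_posneg]_x x.

End mean_of_signed_measure.

Section empirical_measure.
Context {R : realType} (n : nat) (J : pred 'I_n) (x : 'I_n -> R).
Local Open Scope ereal_scope.

Definition empirical (A : set (measurableTypeR R)) : \bar R :=
  (#|J|%:R^-1)%:E * \sum_(j < n | J j) \d_(x j) A.

Let empirical0 : empirical set0 = 0.
Proof. by rewrite /empirical big1 ?mule0. Qed.

Let empirical_ge0 A : 0 <= empirical A.
Proof. by apply: mule_ge0; [rewrite lee_fin|exact: sume_ge0]. Qed.

Let empirical_sigma_additive : semi_sigma_additive empirical.
Proof.
pose z : {measure set (measurableTypeR R) -> \bar R} := mzero.
pose d j : {measure set (measurableTypeR R) -> \bar R} :=
  \d_(x j : measurableTypeR R).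
pose m k := if insub k is Some j then if J j then d j else z else z.
have c0 : (0 <= #|J|%:R^-1 :> R)%R by [].
rewrite (_ : empirical = mscale (NngNum c0) (msum m n)); last first.
  apply/funext => A; rewrite /empirical /mscale /msum big_mkcond/=.
  by congr (_ * _); apply: eq_bigr => j _; rewrite /m valK; case: (J j).
exact: measure_semi_sigma_additive.
Qed.

HB.instance Definition _ := isMeasure.Build _ _ _ empirical
  empirical0 empirical_ge0 empirical_sigma_additive.

Let empirical_fin : fin_num_fun empirical.
Proof.
by move=> A mA; rewrite fin_numM// sum_fin_num; apply/allP => _ /mapP[? _ ->].
Qed.

HB.instance Definition _ := @Measure_isFinite.Build _ _ _ empirical
  empirical_fin.

End empirical_measure.

Section empirical_measures.
Context {R : realType} (n : nat) (x : 'I_n -> R).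
Local Open Scope ereal_scope.

Definition eps_n := empirical xpredT x.

Definition eps_ni (i : 'I_n) := empirical (predC1 i) x.

Lemma eps_nE A : eps_n A = (n%:R^-1)%:E * \sum_(j < n) \d_(x j) A.
Proof. by rewrite /eps_n /empirical card_ord. Qed.

Lemma eps_niE i A :
  eps_ni i A = (n.-1%:R^-1)%:E * \sum_(j < n | j != i) \d_(x j) A.
Proof. by rewrite /eps_ni /empirical cardC1 card_ord. Qed.

End empirical_measures.

Section jackknife.
Context {R : realType} (T : signed_measure R -> R) (n : nat) (x : 'I_n -> R).

Definition pseudovalue (i : 'I_n) : R :=
  n%:R * T (eps_n x) -
  (n%:R - 1) * T (eps_ni x i).

Definition mean_pseudovalue : R := n%:R^-1 * \sum_(j < n) pseudovalue j.

Definition v_jack : R :=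
  (n%:R - 1)^-1 * \sum_(i < n) (pseudovalue i - mean_pseudovalue) ^+ 2.

End jackknife.

Section infinitesimal_jackknife.
Context {R : realType}.

(* dT m q is the functional derivative at m of a functional T, in the
   direction q *)
Variable dT : signed_measure R -> signed_measure R -> R.

Definition influence (m : signed_measure R) (y : R) : R :=
  dT m (cadd (charge_of_finite_measure (\d_(y : measurableTypeR R))) (copp m)).

Definition v_ijack (n : nat) (x : 'I_n -> R) : R :=
  \int[eps_n x]_y influence (eps_n x) y ^+ 2.

End infinitesimal_jackknife.

Section function_of_the_mean.
Context {R : realType} (g : R -> R).

Definition T_mean (m : signed_measure R) : R := g (mean m).

Definition dT_mean (m q : signed_measure R) : R := derive1 g (mean m) * mean q.

End function_of_the_mean.

Section probability.
Context {d : measure_display} {Omega : measurableType d} {R : realType}.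
Variable P : probability Omega R.

Definition mutually_independent (X : nat -> {RV P >-> measurableTypeR R}) :=
  forall (J : {fset nat}) (A : nat -> set (measurableTypeR R)),
    (forall i, measurable (A i)) ->
    P (\bigcap_(i in [set` J]) X i @^-1` A i) =
    (\prod_(i <- J) P (X i @^-1` A i))%E.

Definition is_Op (Y : nat -> Omega -> R) (r : nat -> R) :=
  forall eta : R, 0 < eta -> exists (M : R) (N : nat), forall n : nat,
    (N <= n)%N -> (P [set w | (M * r n < `|Y n w|)%R] < eta%:E)%E.

End probability.

(* Main.v *)
Require Import Defs.
From HB Require Import structures.
From mathcomp Require Import all_boot all_order all_algebra finmap.
From mathcomp Require Import all_classical all_reals all_analysis.
From mathcomp Require Import measurable_realfun.
From mathcomp Require Import ring lra.

Import Order.TTheory GRing.Theory Num.Theory.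
Import numFieldNormedType.Exports.

(** Why the theorem holds.  Write [m] for the sample mean, [d i = x i - m] and
[G = g'(m)].  Deleting the observation [i] moves the mean from [m] to
[m - d i / (n - 1)].  The mean value theorem and the Hölder bound on [g'] give
a first order expansion of [g] at [m] with an error of order [1 + h]
(lemma [taylor1_holder]), hence the pseudovalue is [g m + G * d i + r i] with
[`|r i| <= C * (n - 1)^(-h) * (1 + `|d i|)^(1 + h)]
(lemma [pseudovalue_remainder_le]).  Without the [r i], the jackknife variance
would be [(n - 1)^-1 * \sum (G * d i)^2], and the infinitesimal jackknife
variance is the same sum divided by [n].  Since the [d i] add up to zero, the
difference of the two estimators is bounded by a linear combination of
[n^-1 * \sum d^2], [\sum |d| |r|] and [\sum r^2] (lemma
[perturbed_variance_le]).

Every power of [|d i|] that appears is at most [2 + 2 * h], which is the order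
of the moment available.  So all the sums, and also [G], are controlled by the
single statistic [A = 1 + n^-1 * \sum `|x i|^(2 + 2 * h)], and one obtains the
deterministic inequality
[`|v_jack - v_ijack| <= L * A^6 * n^(-h)] with [L] depending on [g] and [C]
alone (lemma [jackknife_gap_le]).  The expectation of [A] does not depend on
[n], so Markov's inequality bounds [A], and therefore [n^h] times the
difference, in probability.

Two more facts are needed.  The mean of a signed measure is defined through a
Hahn decomposition, so the elementary formulas for [v_jack] and [v_ijack] rest
on [mean_charge_difference], which computes the mean from any representation
of a charge as a difference of two finite measures.  And the difference of the
estimators must be a measurable function of the outcome for its probabilities
to be compared (lemma [measurable_jackknife_gap]). *)

Local Open Scope classical_set_scope.
Local Open Scope ring_scope.

(** * Integrals and means of empirical measures *)

Section empirical_integral.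
Context {R : realType} (n : nat) (J : pred 'I_n) (x : 'I_n -> R).
Local Open Scope ereal_scope.

(** An empirical measure is a rescaled finite sum of Dirac masses, for which
    integrals are known; [m] extends the family indexed by ['I_n] to all of
    [nat] by the zero measure, as [msum] requires. *)
Lemma ge0_integral_empirical (f : R -> \bar R) :
  measurable_fun [set: R] f -> (forall y, 0 <= f y) ->
  \int[empirical J x]_y f y = (#|J|%:R^-1)%:E * \sum_(j < n | J j) f (x j).
Proof.
move=> mf f0.
pose z : {measure set (measurableTypeR R) -> \bar R} := mzero.
pose d j : {measure set (measurableTypeR R) -> \bar R} :=
  \d_(x j : measurableTypeR R).
pose m k := if insub k is Some j then if J j then d j else z else z.
have c0 : (0 <= #|J|%:R^-1 :> R)%R by [].
rewrite (eq_measure_integral (mscale (NngNum c0) (msum m n))); last first.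
  move=> A _ _; rewrite /= /empirical /mscale/= /msum big_mkcond/=.
  by congr (_ * _); apply: eq_bigr => j _; rewrite /m valK; case: (J j).
rewrite ge0_integral_mscale// ge0_integral_measure_sum// /= [in RHS]big_mkcond/=.
congr (_ * _); apply: eq_bigr => j _; rewrite /m valK; case: (J j).
  by rewrite integral_dirac// diracT mul1e.
by rewrite integral_measure_zero.
Qed.

Variables (f : R -> R) (mf : measurable_fun [set: R] f).

Lemma integrable_empirical : (empirical J x).-integrable [set: R] (EFin \o f).
Proof.
apply/integrableP; split; first exact/measurable_EFinP.
rewrite (@ge0_integral_empirical (fun y => `|(f y)%:E|))//.
  by rewrite sumEFin -EFinM ltry.
by apply/measurable_EFinP; exact: measurableT_comp.
Qed.

Lemma Rintegral_empirical :
  (\int[empirical J x]_y f y = #|J|%:R^-1 * \sum_(j < n | J j) f (x j))%R.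
Proof.
have mEf : measurable_fun [set: R] (EFin \o f) by exact/measurable_EFinP.
rewrite /Rintegral integralE !ge0_integral_empirical//; first last.
- exact: measurable_funepos.
- exact: measurable_funeneg.
rewrite funerpos funerneg /= !sumEFin -!EFinM -EFinB /= -mulrBr -sumrB.
by congr (_ * _)%R; apply: eq_bigr => j _; rewrite -[in RHS](funrposBneg f).
Qed.

End empirical_integral.

Section mean_of_difference.
Context {R : realType}.
Variables (m : signed_measure R)
  (m1 m2 : {finite_measure set (measurableTypeR R) -> \bar R}).
Hypothesis mE : forall A, measurable A -> m A = (m1 A - m2 A)%E.

(** A Jordan decomposition is minimal: the positive part of [m1 - m2] is below
    [m1] and its negative part below [m2], which makes both parts integrate the
    identity.  Then [m^+ + m2 = m^- + m1] is an equality of measures, and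
    integrating the identity against both sides gives the claim. *)
Lemma mean_charge_difference :
  m1.-integrable [set: R] (EFin \o id) ->
  m2.-integrable [set: R] (EFin \o id) ->
  mean m = \int[m1]_x x - \int[m2]_x x.
Proof.
move=> i1 i2.
set PN := hahn_posneg m; have [[mP _] [mN _] _ _] := PN.
pose mp : {finite_measure set (measurableTypeR R) -> \bar R} := jordan_pos PN.
pose mn : {finite_measure set (measurableTypeR R) -> \bar R} := jordan_neg PN.
have le_pos A : measurable A -> (mp A <= m1 A)%E.
  move=> mA; have mAP := measurableI A _ mA mP.
  rewrite /mp/= jordan_posE cjordan_posE /crestr0 mem_set// /crestr mE//.
  apply: (@le_trans _ _ (m1 (A `&` hahn_pos m))).
    by rewrite leeBlDr ?fin_num_measure// leeDl.
  by apply: le_measure; rewrite ?inE.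
have le_neg A : measurable A -> (mn A <= m2 A)%E.
  move=> mA; have mAN := measurableI A _ mA mN.
  rewrite /mn/= jordan_negE cjordan_negE /crestr0 mem_set// /crestr mE//.
  apply: (@le_trans _ _ (m2 (A `&` hahn_neg m))).
    rewrite fin_num_oppeB ?fin_num_measure// addeC.
    by rewrite leeBlDr ?fin_num_measure// leeDl.
  by apply: le_measure; rewrite ?inE.
have mid : measurable_fun [set: R] (EFin \o id).
  by case/integrableP : i1.
have ip : mp.-integrable [set: R] (EFin \o id).
  apply/integrableP; split => //; case/integrableP : i1 => _.
  apply: le_lt_trans.
  by apply: ge0_le_measure_integral => //; exact: measurableT_comp.
have iN : mn.-integrable [set: R] (EFin \o id).
  apply/integrableP; split => //; case/integrableP : i2 => _.
  apply: le_lt_trans.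
  by apply: ge0_le_measure_integral => //; exact: measurableT_comp.
have add_eq (A : set (measurableTypeR R)) : measurable A -> A `<=` [set: R] ->
    measure_add mp m2 A = measure_add mn m1 A.
  move=> mA _; rewrite !measure_addE.
  have cross (a b c e : \bar R) : a \is a fin_num -> b \is a fin_num ->
      c \is a fin_num -> e \is a fin_num ->
      (a - b = c - e)%E -> (a + e = b + c)%E.
    case: a b c e => [a||] [b||] [c||] [e||]// _ _ _ _.
    by rewrite -!EFinD => -[E]; congr EFin; lra.
  apply: cross; rewrite ?fin_num_measure//.
  by rewrite -mE// (jordan_decomp PN mA) /cadd/= cscaleN1.
have E : \int[mp]_x x + \int[m2]_x x = \int[mn]_x x + \int[m1]_x x.
  have fin (mu : {measure set (measurableTypeR R) -> \bar R}) :
      mu.-integrable [set: R] (EFin \o id) ->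
      (\int[mu]_x x%:E)%E \is a fin_num.
    exact: integrable_fin_num.
  rewrite /Rintegral -!fineD; try exact: fin.
  rewrite -!integral_measure_add//; congr fine; exact: eq_measure_integral.
rewrite -[mean m]/(\int[mp]_x x - \int[mn]_x x).
by move: E; set a := Rintegral mp _ _; set b := Rintegral mn _ _;
  set c := Rintegral m1 _ _; set e := Rintegral m2 _ _ => E; lra.
Qed.

End mean_of_difference.

Section mean_values.
Context {R : realType} (n : nat) (x : 'I_n -> R).

Lemma mean_empirical (J : pred 'I_n) :
  mean (empirical J x) = #|J|%:R^-1 * \sum_(j < n | J j) x j.
Proof.
(* The empirical measure over no index is the zero measure. *)
rewrite (@mean_charge_difference _ _ (empirical J x) (empirical pred0 x)).
- by rewrite !Rintegral_empirical// [in X in _ - X]big_pred0// mulr0 subr0.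
- move=> A mA /=; rewrite [in X in (_ - X)%E]/empirical big_pred0//.
  by rewrite mule0 sube0.
- exact: integrable_empirical.
- exact: integrable_empirical.
Qed.

Lemma mean_dirac_empirical (J : pred 'I_n) (y : R) :
  mean (cadd (charge_of_finite_measure (\d_(y : measurableTypeR R)))
         (copp (empirical J x))) =
  y - #|J|%:R^-1 * \sum_(j < n | J j) x j.
Proof.
(* The Dirac mass at [y] is the empirical measure of the sample [y]. *)
rewrite (@mean_charge_difference _ _ (eps_n (fun _ : 'I_1 => y))
  (empirical J x)).
- by rewrite !Rintegral_empirical// card_ord invr1 mul1r big_ord1.
- by move=> A mA; rewrite /= -/(eps_n _) eps_nE invr1 mul1e big_ord1.
- exact: integrable_empirical.
- exact: integrable_empirical.
Qed.

Variable g : R -> R.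

Lemma v_ijack_mean (G := derive1 g) (m := n%:R^-1 * \sum_(j < n) x j) :
  v_ijack (dT_mean g) x = n%:R^-1 * \sum_(i < n) (G m * (x i - m)) ^+ 2.
Proof.
have infl y : influence (dT_mean g) (eps_n x) y = G m * (y - m).
  by rewrite /influence /dT_mean mean_dirac_empirical mean_empirical card_ord.
rewrite /v_ijack; under eq_Rintegral do rewrite infl.
rewrite Rintegral_empirical ?card_ord//.
apply: measurable_funX; apply: measurable_funM => //; exact: measurable_funB.
Qed.

Lemma pseudovalue_mean (m := n%:R^-1 * \sum_(j < n) x j) i : (1 < n)%N ->
  pseudovalue (T_mean g) x i =
  n%:R * g m - (n%:R - 1) * g (m - (x i - m) / (n%:R - 1)).
Proof.
move=> n1; rewrite /pseudovalue /T_mean !mean_empirical card_ord.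
congr (_ - _ * g _); rewrite cardC1 card_ord /m.
rewrite [in RHS](bigD1 i)//= (eq_bigl (fun j => j != i))//.
set S := \sum_(j < n | j != i) x j.
have n0 : n%:R != 0 :> R by rewrite pnatr_eq0 -lt0n (ltn_trans _ n1).
have n10 : n%:R - 1 != 0 :> R by rewrite subr_eq0 pnatr_eq1 gtn_eqF.
rewrite -subn1 natrB ?(ltnW n1)//.
by field; rewrite n10 n0.
Qed.

End mean_values.

(** * First order expansion with a Hölder derivative *)

Section holder_remainder.
Context {R : realType} (g : R -> R) (h C : R).
Hypothesis g_derivable : forall x : R, derivable g x 1.

(** The mean value theorem without assuming which of [x] and [y] is larger:
    the intermediate point is at least as close to [x] as [y] is. *)
Lemma mean_value_between (x y : R) :
  exists2 c, `|c - x| <= `|y - x| & g y - g x = derive1 g c * (y - x).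
Proof.
have dg (z : R) : is_derive z 1 g (derive1 g z).
  by rewrite derive1E; exact: derivableP.
have cg a b : {within `[a, b], continuous g}.
  by apply: derivable_within_continuous => z _; exact: g_derivable.
have [xy|/ltW yx] := leP x y.
- have [c] := MVT_segment xy (fun z _ => dg z) (@cg x y).
  rewrite in_itv/= => /andP[xc cy] ->; exists c => //.
  by rewrite !ger0_norm ?subr_ge0// lerD2r.
- have [c] := MVT_segment yx (fun z _ => dg z) (@cg y x).
  rewrite in_itv/= => /andP[yc cx] E; exists c.
    by rewrite !ler0_norm ?subr_le0// lerN2 lerD2r.
  by rewrite -opprB E -mulrN opprB.
Qed.

Hypothesis h_ge0 : 0 <= h.
Hypothesis g'_holder :
  forall x y : R, `|derive1 g x - derive1 g y| <= C * `|x - y| `^ h.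

Lemma holder_const_ge0 : 0 <= C.
Proof.
have := g'_holder 1 0; rewrite subr0 normr1 powR1 mulr1.
exact: le_trans.
Qed.

Lemma taylor1_holder (x y : R) :
  `|g y - g x - derive1 g x * (y - x)| <= C * `|y - x| `^ h * `|y - x|.
Proof.
have [c cxy ->] := mean_value_between x y.
rewrite -mulrBl normrM ler_wpM2r// (le_trans (g'_holder _ _))//.
rewrite ler_wpM2l ?holder_const_ge0//.
by apply: ge0_ler_powR; rewrite ?nnegrE.
Qed.

End holder_remainder.

(** * Sample variance under a perturbation *)

Section perturbed_variance.
Context {R : realFieldType} (n : nat) (a G : R) (d r : 'I_n -> R).
Hypothesis n_gt1 : (1 < n)%N.
Hypothesis sum_d : \sum_(i < n) d i = 0.

Let Q i := a + G * d i + r i.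

(** The [d i] being centred, the empirical mean of [Q] is [a] plus that of [r],
    and the cross terms between [d] and the mean of [r] vanish.  The first
    summand of the bound is the gap between the normalisations [(n - 1)^-1] and
    [n^-1]. *)
Lemma perturbed_variance_le :
  `|(n%:R - 1)^-1 * \sum_(i < n) (Q i - n%:R^-1 * \sum_(j < n) Q j) ^+ 2 -
    n%:R^-1 * \sum_(i < n) (G * d i) ^+ 2| <=
  (n%:R - 1)^-1 * (G ^+ 2 * (n%:R^-1 * \sum_(i < n) d i ^+ 2) +
    2 * `|G| * \sum_(i < n) `|d i| * `|r i| + \sum_(i < n) r i ^+ 2).
Proof.
have n0 : n%:R != 0 :> R by rewrite pnatr_eq0 -lt0n (ltn_trans _ n_gt1).
have n1 : 0 < n%:R - 1 :> R by rewrite subr_gt0 ltr1n.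
set S := \sum_(i < n) d i ^+ 2; set D := \sum_(i < n) d i * r i.
set rb := n%:R^-1 * \sum_(i < n) r i; set V := \sum_(i < n) (r i - rb) ^+ 2.
have sumr : \sum_(i < n) r i = n%:R * rb by rewrite /rb mulrA divff ?mul1r.
have meanQ : n%:R^-1 * \sum_(j < n) Q j = a + rb.
  rewrite /Q !big_split/= -mulr_sumr sum_d mulr0 addr0 sumr.
  by rewrite sumr_const card_ord -[a *+ n]mulr_natr; field.
have sumQ : \sum_(i < n) (Q i - (a + rb)) ^+ 2 = G ^+ 2 * S + 2 * G * D + V.
  under eq_bigr => i _.
    rewrite (_ : _ ^+ 2 = G ^+ 2 * d i ^+ 2 + 2 * G * (d i * r i) -
      2 * G * rb * d i + (r i - rb) ^+ 2); last by rewrite /Q; ring.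
    over.
  by rewrite !big_split/= sumrN -!mulr_sumr sum_d mulr0 subr0.
have V0 : 0 <= V by apply: sumr_ge0 => i _; exact: sqr_ge0.
have Vr : V <= \sum_(i < n) r i ^+ 2.
  have -> : V = \sum_(i < n) r i ^+ 2 - n%:R * rb ^+ 2.
    rewrite /V (eq_bigr (fun i => r i ^+ 2 - 2 * rb * r i + rb ^+ 2)); last first.
      by move=> i _; ring.
    rewrite !big_split/= sumrN -mulr_sumr sumr sumr_const card_ord.
    rewrite -[_ *+ n]mulr_natr.
    by ring.
  by rewrite lerBlDr lerDl mulr_ge0// sqr_ge0.
have GS : \sum_(i < n) (G * d i) ^+ 2 = G ^+ 2 * S.
  by rewrite mulr_sumr; apply: eq_bigr => i _; rewrite exprMn.
have normD : `|D| <= \sum_(i < n) `|d i| * `|r i|.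
  by rewrite (le_trans (ler_norm_sum _ _ _))//; under eq_bigr do rewrite normrM.
rewrite meanQ sumQ GS.
rewrite (_ : _ - _ = (n%:R - 1)^-1 *
  (G ^+ 2 * (n%:R^-1 * S) + 2 * G * D + V)); last first.
  by field; rewrite n0 gt_eqF.
rewrite normrM gtr0_norm ?invr_gt0// ler_pM2l ?invr_gt0//.
rewrite (le_trans (ler_normD _ _))// lerD//; last by rewrite ger0_norm.
rewrite (le_trans (ler_normD _ _))// lerD//.
  rewrite ger0_norm// mulr_ge0 ?sqr_ge0// mulr_ge0// sumr_ge0// => i _.
  exact: sqr_ge0.
by rewrite !normrM ger0_norm// ler_wpM2l// mulr_ge0.
Qed.

End perturbed_variance.

(** * Bounds in terms of one empirical moment *)

Section moment_bounds.
Context {R : realType} (n : nat) (h : R) (x : 'I_n -> R).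
Hypothesis n_gt0 : (0 < n)%N.
Hypothesis h_ge0 : 0 <= h.
Hypothesis h_le1 : h <= 1.

Let p := 2 + 2 * h.
Let m := n%:R^-1 * \sum_(i < n) x i.
Let A := 1 + n%:R^-1 * \sum_(i < n) `|x i| `^ p.

Let p_ge0 : 0 <= p. Proof. by rewrite addr_ge0 ?mulr_ge0. Qed.

Let n0 : n%:R != 0 :> R. Proof. by rewrite pnatr_eq0 -lt0n. Qed.

Lemma power_mean_ge1 : 1 <= A.
Proof.
by rewrite lerDl mulr_ge0 ?invr_ge0// sumr_ge0// => i _; exact: powR_ge0.
Qed.

Lemma le_1Dpowr (t : R) : 0 <= t -> t <= 1 + t `^ p.
Proof.
move=> t0; have [t1|/ltW t1] := leP t 1.
  by rewrite (le_trans t1)// lerDl powR_ge0.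
rewrite (le_trans (_ : t <= t `^ p))//; last by rewrite lerDr.
by rewrite -{1}(powRr1 t0) ler_powR// /p; move: h_ge0 h_le1; lra.
Qed.

Lemma norm_mean_le : `|m| <= A.
Proof.
rewrite /m normrM ger0_norm ?invr_ge0//.
have -> : A = n%:R^-1 * \sum_(i < n) (1 + `|x i| `^ p).
  by rewrite big_split/= sumr_const card_ord mulrDr mulVf.
rewrite ler_wpM2l ?invr_ge0// (le_trans (ler_norm_sum _ _ _))//.
by apply: ler_sum => i _; exact: le_1Dpowr.
Qed.

(** The larger summand is at least half of the sum, and [p <= 4] turns the
    factor [2 `^ p] into [16]. *)
Lemma powRD_le (s t : R) : 0 <= s -> 0 <= t ->
  (s + t) `^ p <= 16 * (s `^ p + t `^ p).
Proof.
move=> s0 t0.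
wlog st : s t s0 t0 / s <= t.
  move=> H; have [|/ltW] := leP s t; first exact: H.
  by move=> ts; rewrite addrC [X in 16 * X]addrC; exact: H.
apply: (@le_trans _ _ ((2 * t) `^ p)).
  by apply: ge0_ler_powR; rewrite ?p_ge0 ?nnegrE//; lra.
rewrite powRM// ler_pM ?powR_ge0//; last by rewrite lerDr powR_ge0.
rewrite (_ : 16 = 2 `^ 4%:R).
  by rewrite ler_powR ?ler1n// /p; move: h_ge0 h_le1; lra.
by rewrite powR_mulrn// -natrX.
Qed.

(** As [`|m| <= A], centring costs no more than replacing [1 + `|x i - m|] by
    [2 * A + `|x i|]; the constant is [272 = 16 * 16 + 16]. *)
Lemma power_mean_centered_le :
  n%:R^-1 * \sum_(i < n) (1 + `|x i - m|) `^ p <= 272 * A ^+ 4.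
Proof.
have A1 := power_mean_ge1; have A0 : 0 <= A by lra.
have term i : (1 + `|x i - m|) `^ p <= 16 * (16 * A ^+ 4 + `|x i| `^ p).
  apply: (@le_trans _ _ ((2 * A + `|x i|) `^ p)).
    apply: ge0_ler_powR; rewrite ?p_ge0 ?nnegrE ?addr_ge0 ?mulr_ge0//.
    by have := norm_mean_le; have := ler_normB (x i) m; lra.
  rewrite (le_trans (powRD_le _ _ _ _))// ?mulr_ge0// ler_wpM2l// lerD2r.
  apply: (@le_trans _ _ ((2 * A) `^ 4%:R)).
    by rewrite ler_powR// /p; move: h_ge0 h_le1; lra.
  by rewrite powR_mulrn ?mulr_ge0// exprMn -natrX.
apply: (@le_trans _ _
    (n%:R^-1 * \sum_(i < n) 16 * (16 * A ^+ 4 + `|x i| `^ p))).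
  by rewrite ler_wpM2l ?invr_ge0//; apply: ler_sum.
rewrite -mulr_sumr big_split/= sumr_const card_ord
  -[(16 * A ^+ 4) *+ n]mulr_natr.
set S := \sum_(i < n) _; have AE : n%:R^-1 * S = A - 1 by rewrite /A addrC addKr.
rewrite (_ : n%:R^-1 * _ = 256 * A ^+ 4 + 16 * (n%:R^-1 * S)); last first.
  by field; rewrite n0.
have : A <= A ^+ 4 by rewrite exprS ler_peMr// exprn_ege1.
by rewrite AE; lra.
Qed.

End moment_bounds.

(** * Deterministic comparison of the two estimators *)

Section jackknife_gap.
Context {R : realType} (g : R -> R) (h C : R) (n : nat) (x : 'I_n -> R).
Hypothesis g_derivable : forall x : R, derivable g x 1.
Hypothesis h_ge0 : 0 <= h.
Hypothesis h_le1 : h <= 1.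
Hypothesis g'_holder :
  forall x y : R, `|derive1 g x - derive1 g y| <= C * `|x - y| `^ h.
Hypothesis n_gt1 : (1 < n)%N.

Let K := `|derive1 g 0| + C.
Let A := 1 + n%:R^-1 * \sum_(i < n) `|x i| `^ (2 + 2 * h).
Let m := n%:R^-1 * \sum_(i < n) x i.
Let G := derive1 g m.
Let d i := x i - m.
Let nu : R := (n%:R - 1) `^ (- h).
Let r i := pseudovalue (T_mean g) x i - g m - G * d i.

Let C_ge0 : 0 <= C. Proof. exact: holder_const_ge0 g'_holder. Qed.
Let n_gt0 : (0 < n)%N. Proof. exact: ltn_trans n_gt1. Qed.
Let N1 : 1 <= n%:R - 1 :> R.
Proof. by rewrite lerBrDr -(natrD _ 1 1) ler_nat. Qed.

Lemma derive1_mean_le : `|G| <= K * A.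
Proof.
have A1 : 1 <= A by exact: power_mean_ge1.
have mA : `|m| <= A by exact: norm_mean_le.
have : `|G| <= `|derive1 g 0| + C * `|m| `^ h.
  rewrite -[G](subrK (derive1 g 0)) addrC (le_trans (ler_normD _ _))// lerD2l.
  by rewrite (le_trans (g'_holder _ _))// subr0.
move=> /le_trans; apply; rewrite /K mulrDl lerD//.
  by rewrite -{1}(mulr1 `|derive1 g 0|) ler_wpM2l.
rewrite ler_wpM2l// (@le_trans _ _ (A `^ h))//.
  by apply: ge0_ler_powR; rewrite ?nnegrE//; lra.
by rewrite ler1_powR.
Qed.

(** The expansion error for the step [d i / (n - 1)] is of order [1 + h], and
    the pseudovalue multiplies it by [n - 1]: a factor [(n - 1) `^ (- h)]
    survives.  Majorizing [`|d i|] by [1 + `|d i|] makes powers with smaller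
    exponents comparable to it later on. *)
Lemma pseudovalue_remainder_le i : `|r i| <= C * nu * (1 + `|d i|) `^ (1 + h).
Proof.
have N0 : 0 < n%:R - 1 :> R by move: N1; lra.
pose e := d i / (n%:R - 1).
have -> : r i = - ((n%:R - 1) * (g (m - e) - g m - G * ((m - e) - m))).
  rewrite /r pseudovalue_mean// -/m -/(d i) -/e.
  rewrite (_ : d i = e * (n%:R - 1)); first by ring.
  by rewrite /e divfK// gt_eqF.
rewrite normrN normrM (gtr0_norm N0).
have expansion := taylor1_holder _ _ _ g_derivable h_ge0 g'_holder m (m - e).
rewrite (le_trans (ler_wpM2l (ltW N0) expansion))//.
have -> : `|m - e - m| = `|d i| / (n%:R - 1).
  by rewrite addrAC subrr add0r normrN normrM normfV (gtr0_norm N0).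
have nuE : (n%:R - 1)^-1 `^ h = nu.
  by rewrite -powR_inv1 ?(ltW N0)// -powRrM mulN1r.
rewrite powRM ?invr_ge0 ?(ltW N0)// nuE.
rewrite (_ : (n%:R - 1) * _ = C * nu * (`|d i| * `|d i| `^ h)); last first.
  by field; rewrite gt_eqF.
have u0 : 0 < 1 + `|d i| by rewrite ltr_pwDl.
rewrite ler_wpM2l ?mulr_ge0 ?powR_ge0//.
rewrite powRD ?(gt_eqF u0) ?implybT// powRr1 ?(ltW u0)//.
rewrite ler_pM ?powR_ge0 ?lerDr//.
by apply: ge0_ler_powR; rewrite ?nnegrE ?lerDr// ltW.
Qed.

(** The first bound uses [h <= 1]: this is where the gap between the two
    normalisations, of order [n^-1], is absorbed in the rate [n `^ (- h)]. *)
Lemma deletion_rate_bounds :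
  (n%:R - 1)^-1 <= nu /\ nu <= 1 /\ nu <= 2 * n%:R `^ (- h).
Proof.
have N0 : 0 < n%:R - 1 :> R by move: N1; lra.
split.
  by rewrite -powR_inv1 ?(ltW N0)// ler_powR//; move: N1 h_ge0 h_le1; lra.
split; first by rewrite -(powRr0 (n%:R - 1)) ler_powR//; move: N1 h_ge0 h_le1; lra.
have nn : 0 < n%:R :> R by rewrite ltr0n.
rewrite /nu !powRN -[leRHS]invrK lef_pV2 ?posrE;
  rewrite ?invr_gt0 ?mulr_gt0 ?invr_gt0 ?powR_gt0//.
rewrite invfM invrK ler_pdivrMl//.
apply: (@le_trans _ _ ((2 * (n%:R - 1)) `^ h)).
  by apply: ge0_ler_powR; rewrite ?nnegrE//; move: N1; lra.
rewrite powRM ?(ltW N0)// ler_wpM2r ?powR_ge0//.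
by rewrite ler1_powR// ler1n.
Qed.

(** With [w i = (1 + `|d i|) `^ (1 + h)], the three sums of
    [perturbed_variance_le] are all bounded through [M], the empirical mean of
    the [w i ^+ 2].  Then [M <= 272 * A ^+ 4], [`|G| <= K * A] and [C <= K * A]
    give the power [A ^+ 6], and the constant is [3808 = 2 * 272 * 7]. *)
Lemma jackknife_gap_le :
  `|v_jack (T_mean g) x - v_ijack (dT_mean g) x| <=
  3808 * K ^+ 2 * A ^+ 6 * n%:R `^ (- h).
Proof.
have A1 : 1 <= A by exact: power_mean_ge1.
have [Wnu [nu1 nu2]] := deletion_rate_bounds.
have nu0 : 0 <= nu by exact: powR_ge0.
have N0 : 0 < n%:R - 1 :> R by move: N1; lra.
have nn : 0 < n%:R :> R by rewrite ltr0n.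
pose w i := (1 + `|d i|) `^ (1 + h).
have w_ge i : `|d i| <= w i.
  have u1 : 1 <= 1 + `|d i| by rewrite lerDl.
  rewrite (@le_trans _ _ (1 + `|d i|)) ?lerDr//.
  by rewrite -{1}(powRr1 (le_trans ler01 u1)) ler_powR// lerDl.
pose M := n%:R^-1 * \sum_(i < n) w i ^+ 2.
have MA : M <= 272 * A ^+ 4.
  rewrite (_ : M = n%:R^-1 * \sum_(i < n) (1 + `|x i - m|) `^ (2 + 2 * h)).
    exact: power_mean_centered_le.
  congr (_ * _); apply: eq_bigr => i _; rewrite expr2 /w -powRD ?/d.
    by congr powR; ring.
  by rewrite [X in _ ==> ~~ X]gt_eqF ?implybT// ltr_pwDl.
have sumw : \sum_(i < n) w i ^+ 2 = n%:R * M.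
  by rewrite mulrA divff ?gt_eqF ?mul1r.
have M0 : 0 <= M.
  by rewrite mulr_ge0 ?invr_ge0 ?(ltW nn)// sumr_ge0// => i _; exact: sqr_ge0.
have r_le i : `|r i| <= C * nu * w i by exact: pseudovalue_remainder_le.
have d2_le : n%:R^-1 * \sum_(i < n) d i ^+ 2 <= M.
  rewrite ler_wpM2l ?invr_ge0 ?(ltW nn)//; apply: ler_sum => i _.
  by rewrite -[leLHS]real_normK ?num_real// ler_pXn2r ?nnegrE ?powR_ge0.
have d2_ge0 : 0 <= n%:R^-1 * \sum_(i < n) d i ^+ 2.
  by rewrite mulr_ge0 ?invr_ge0 ?(ltW nn)// sumr_ge0// => i _; exact: sqr_ge0.
have dr_le : \sum_(i < n) `|d i| * `|r i| <= C * nu * (n%:R * M).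
  rewrite -sumw mulr_sumr; apply: ler_sum => i _.
  rewrite expr2 mulrA [leRHS]mulrC ler_pM//.
have r2_le : \sum_(i < n) r i ^+ 2 <= C ^+ 2 * nu * (n%:R * M).
  rewrite -sumw mulr_sumr; apply: ler_sum => i _.
  apply: (@le_trans _ _ ((C * nu * w i) ^+ 2)).
    rewrite -[leLHS]real_normK ?num_real//.
    by rewrite ler_pXn2r ?nnegrE ?(le_trans _ (r_le i)).
  rewrite !exprMn ler_wpM2r ?sqr_ge0// ler_wpM2l ?sqr_ge0//.
  by rewrite expr2 ler_piMl.
have sumd : \sum_(i < n) d i = 0.
  rewrite /d big_split/= sumrN sumr_const card_ord -[m *+ n]mulr_natl.
  by rewrite mulrA divff ?gt_eqF// mul1r subrr.
have pvE : pseudovalue (T_mean g) x =1 (fun i => g m + G * d i + r i).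
  by move=> i; rewrite /r; ring.
have -> : v_jack (T_mean g) x = (n%:R - 1)^-1 * \sum_(i < n)
    (g m + G * d i + r i - n%:R^-1 * \sum_(j < n) (g m + G * d j + r j)) ^+ 2.
  rewrite /v_jack /mean_pseudovalue (eq_bigr _ (fun i _ => pvE i)).
  by congr (_ * _); apply: eq_bigr => i _; rewrite pvE.
rewrite v_ijack_mean (le_trans (perturbed_variance_le _ (g m) G d r n_gt1 sumd))//.
have CnuM : 0 <= C * nu * M := mulr_ge0 (mulr_ge0 C_ge0 nu0) M0.
have Wn : (n%:R - 1)^-1 * n%:R <= 2 :> R.
  by rewrite ler_pdivrMl//; move: N1; lra.
have W0 : 0 <= (n%:R - 1)^-1 :> R by rewrite invr_ge0 ltW.
apply: (@le_trans _ _ (nu * M * (`|G| ^+ 2 + 4 * `|G| * C + 2 * C ^+ 2))).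
  apply: (@le_trans _ _ (nu * (`|G| ^+ 2 * M) +
      2 * (2 * `|G| * (C * nu * M)) + 2 * (C ^+ 2 * nu * M))).
    rewrite !mulrDr; apply: lerD; first apply: lerD.
    - rewrite real_normK ?num_real//; apply: ler_pM => //.
        by rewrite mulr_ge0 ?sqr_ge0.
      by apply: ler_wpM2l d2_le; exact: sqr_ge0.
    - apply: (@le_trans _ _ ((n%:R - 1)^-1 * (2 * `|G| * (C * nu * (n%:R * M))))).
        by rewrite ler_wpM2l// ler_wpM2l// mulr_ge0.
      rewrite [leLHS](_ : _ = ((n%:R - 1)^-1 * n%:R) *
        (2 * `|G| * (C * nu * M))); last by ring.
      by rewrite ler_wpM2r// mulr_ge0// mulr_ge0.
    - apply: (@le_trans _ _ ((n%:R - 1)^-1 * (C ^+ 2 * nu * (n%:R * M)))).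
        by rewrite ler_wpM2l.
      rewrite [leLHS](_ : _ = ((n%:R - 1)^-1 * n%:R) * (C ^+ 2 * nu * M));
        last by ring.
      by rewrite ler_wpM2r// mulr_ge0// mulr_ge0 ?sqr_ge0.
  by rewrite le_eqVlt; apply/orP; left; apply/eqP; ring.
have K0 : 0 <= K by rewrite addr_ge0.
have CK : C <= K * A.
  rewrite (@le_trans _ _ K) ?lerDr//.
  by rewrite -{1}(mulr1 K) ler_wpM2l.
have GK := derive1_mean_le.
rewrite [leRHS](_ : _ = 2 * n%:R `^ (- h) * (272 * A ^+ 4) *
  (7 * (K * A) ^+ 2)); last by ring.
have G0 : 0 <= `|G| by [].
apply: ler_pM; first exact: mulr_ge0.
- by rewrite !addr_ge0 ?sqr_ge0// mulr_ge0 ?sqr_ge0// mulr_ge0.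
- exact: ler_pM.
- have KA0 : 0 <= K * A by rewrite (le_trans G0).
  have := lerXn2r 2 G0 KA0 GK; have := lerXn2r 2 C_ge0 KA0 CK.
  have := ler_pM G0 C_ge0 GK CK.
  move: (K * A) `|G| => B t; rewrite -[B * B]expr2; lra.
Qed.

End jackknife_gap.

(** * Random samples *)

Section sample.
Context {R : realType} (d : measure_display) (Omega : measurableType d)
  (P : probability Omega R) (X : nat -> {RV P >-> measurableTypeR R}).

Let mX i : measurable_fun setT (X i : Omega -> R).
Proof. exact: (@measurable_funPT _ _ _ _ (X i)). Qed.

Let mmean n : measurable_fun setT (fun w : Omega => n%:R^-1 * \sum_(i < n) X i w).
Proof. by apply: measurable_funM => //; apply: measurable_sum. Qed.

Lemma measurable_jackknife_gap (g : R -> R) (n : nat) : (1 < n)%N ->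
  continuous g -> continuous (derive1 g) ->
  measurable_fun setT (fun w => v_jack (T_mean g) (fun i : 'I_n => X i w) -
                                v_ijack (dT_mean g) (fun i : 'I_n => X i w)).
Proof.
move=> n1 /continuous_measurable_fun mg /continuous_measurable_fun mg'.
have mpv (i : 'I_n) : measurable_fun setT
    (fun w => pseudovalue (T_mean g) (fun i : 'I_n => X i w) i).
  under eq_fun do rewrite pseudovalue_mean//.
  apply: measurable_funB; apply: measurable_funM => //.
    by apply: (measurableT_comp mg); exact: mmean.
  apply: (measurableT_comp mg); apply: measurable_funB; first exact: mmean.
  by apply: measurable_funM => //; apply: measurable_funB => //; exact: mmean.
apply: measurable_funB.
  apply: measurable_funM => //; apply: measurable_sum => i.
  apply: measurable_funX; apply: measurable_funB => //.
  by apply: measurable_funM => //; apply: measurable_sum.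
under eq_fun do rewrite v_ijack_mean.
apply: measurable_funM => //; apply: measurable_sum => i.
apply: measurable_funX; apply: measurable_funM.
  by apply: (measurableT_comp mg'); exact: mmean.
by apply: measurable_funB => //; exact: mmean.
Qed.

Variables (p : probability (measurableTypeR R) R) (s : R).
Hypothesis X_law : forall i (A : set (measurableTypeR R)),
  measurable A -> distribution P (X i) A = p A.
Variable mu : R.
Hypothesis muE : (\int[p]_x (`|x| `^ s)%:E = mu%:E)%E.

Let powmean n (w : Omega) := 1 + n%:R^-1 * \sum_(i < n) `|X i w| `^ s.

Let mabsX i : measurable_fun setT (fun w : Omega => `|X i w| `^ s).
Proof.
apply: (measurableT_comp (measurable_powR s)).
exact: measurableT_comp.
Qed.

Lemma measurable_power_mean n : measurable_fun setT (powmean n).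
Proof.
apply: measurable_funD => //; apply: measurable_funM => //.
exact: measurable_sum.
Qed.

Lemma integral_power_mean n : (0 < n)%N ->
  (\int[P]_w (powmean n w)%:E = (1 + mu)%:E)%E.
Proof.
move=> n0.
have one i : (\int[P]_w (`|X i w| `^ s)%:E = mu%:E)%E.
  rewrite -muE.
  transitivity (\int[distribution P (X i)]_x (`|x| `^ s)%:E)%E.
    rewrite ge0_integral_distribution//.
    apply/measurable_EFinP; apply: (measurableT_comp (measurable_powR s)).
    exact: normr_measurable.
  by apply: eq_measure_integral => A mA _; exact: X_law.
under eq_integral do rewrite EFinD EFinM -sumEFin.
rewrite ge0_integralD//; last 2 first.
- move=> w _; apply: mule_ge0; first by rewrite lee_fin invr_ge0.
  by apply: sume_ge0 => i _; rewrite lee_fin powR_ge0.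
- apply: emeasurable_funM => //; apply: emeasurable_sum => i.
  exact/measurable_EFinP.
have -> : (\int[P]_w (1 : R)%:E = 1)%E.
  by rewrite integral_cst// mul1e; exact: probability_setT.
rewrite ge0_integralZl//; last 2 first.
- apply: emeasurable_sum => i; exact/measurable_EFinP.
- by move=> w _; rewrite sume_ge0// => i _; rewrite lee_fin powR_ge0.
rewrite ge0_integral_sum//; last first.
  by move=> i; exact/measurable_EFinP.
rewrite (eq_bigr _ (fun (i : 'I_n) _ => one i)) sumEFin sumr_const card_ord.
by rewrite -EFinM -[mu *+ n]mulr_natl mulKf// pnatr_eq0 -lt0n.
Qed.

(** This is Markov's inequality; the bound is uniform in [n], as only the
    common law of the observations enters the expectation. *)
Lemma power_mean_tail n (a : R) : (0 < n)%N -> 0 < a ->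
  (a%:E * P [set w | (a <= powmean n w)%R] <= (1 + mu)%:E)%E.
Proof.
move=> n0 a0; rewrite -(integral_power_mean _ n0).
have pm0 w : 0 <= powmean n w.
  by rewrite addr_ge0// mulr_ge0 ?invr_ge0// sumr_ge0// => i _; exact: powR_ge0.
have := @le_integral_abse _ _ _ P setT measurableT (EFin \o powmean n) a.
rewrite setTI => /(_ _ a0).
have -> : (\int[P]_x `|(EFin \o powmean n) x| = \int[P]_w (powmean n w)%:E)%E.
  by apply: eq_integral => w _ /=; rewrite ger0_norm.
have -> : [set x | (a%:E <= `|(EFin \o powmean n) x|)%E] =
    [set w | a <= powmean n w].
  by apply/seteqP; split => w /=; rewrite lee_fin ger0_norm.
by apply; apply/measurable_EFinP; exact: measurable_power_mean.
Qed.

End sample.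

Theorem proposition3p1 (R : realType) (g : R -> R) (h C : R)
    (p : probability (measurableTypeR R) R)
    (d : measure_display) (Omega : measurableType d) (P : probability Omega R)
    (X : nat -> {RV P >-> measurableTypeR R})
    (g_derivable : forall x : R, derivable g x 1)
    (g'_continuous : continuous (derive1 g))
    (h_gt : 2^-1 < h) (h_le : h <= 1)
    (g'_holder : forall x y : R, `|derive1 g x - derive1 g y| <= C * `|x - y| `^ h)
    (p_moment : (\int[p]_x (`|x| `^ (2 + 2 * h))%:E < +oo)%E)
    (X_indep : mutually_independent X)
    (X_law : forall i (A : set (measurableTypeR R)),
      measurable A -> distribution P (X i) A = p A) :
  is_Op P
    (fun n w => v_jack (T_mean g) (fun i : 'I_n => X i w) -
                v_ijack (dT_mean g) (fun i : 'I_n => X i w))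
    (fun n => n%:R `^ (- h)).
Proof.
move=> eta eta0.
have h0 : 0 <= h by lra.
have moment_ge0 : (0 <= \int[p]_x (`|x| `^ (2 + 2 * h))%:E)%E.
  by apply: integral_ge0 => x _; rewrite lee_fin powR_ge0.
pose mu := fine (\int[p]_x (`|x| `^ (2 + 2 * h))%:E)%E.
have muE : (\int[p]_x (`|x| `^ (2 + 2 * h))%:E = mu%:E)%E.
  by rewrite fineK// ge0_fin_numE.
have mu0 : 0 <= mu by rewrite fine_ge0.
(* The expectation of the power mean is [1 + mu], so that Markov's inequality
   at level [a] gives a probability at most [(1 + mu) / a < eta]. *)
pose a := (2 + mu) / eta.
have a0 : 0 < a by rewrite divr_gt0//; lra.
pose gap n w := v_jack (T_mean g) (fun i : 'I_n => X i w) -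
  v_ijack (dT_mean g) (fun i : 'I_n => X i w).
have cg : continuous g.
  move=> x; apply: differentiable_continuous; exact/derivable1_diffP.
have [L L0 gap_le] : exists2 L, 0 <= L & forall n (x : 'I_n -> R), (1 < n)%N ->
    `|v_jack (T_mean g) x - v_ijack (dT_mean g) x| <=
    L * (1 + n%:R^-1 * \sum_(i < n) `|x i| `^ (2 + 2 * h)) ^+ 6 * n%:R `^ (- h).
  exists (3808 * (`|derive1 g 0| + C) ^+ 2).
    by apply: mulr_ge0; [exact: ler0n|exact: sqr_ge0].
  by move=> n x n1; exact: jackknife_gap_le.
exists (L * a ^+ 6), 2%N => n n2.
have n0 : (0 < n)%N by exact: ltn_trans n2.
have := power_mean_tail _ _ P X p _ X_law mu muE n a n0 a0.
set E := [set w | _] => tail.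
have mgap : measurable [set w | L * a ^+ 6 * n%:R `^ (- h) < `|gap n w|].
  rewrite (_ : [set _ | _] =
      (Num.norm \o gap n) @^-1` [set` `]L * a ^+ 6 * n%:R `^ (- h), +oo[]); last first.
    by apply/seteqP; split => w /=; rewrite in_itv/= andbT.
  rewrite -[X in measurable X]setTI.
  have mY : measurable_fun setT (Num.norm \o gap n).
    by apply: measurableT_comp => //; exact: measurable_jackknife_gap.
  by apply: mY => //; exact: measurable_itv.
have mE : measurable E.
  rewrite (_ : E = (fun w => 1 + n%:R^-1 *
      \sum_(i < n) `|X i w| `^ (2 + 2 * h)) @^-1` [set` `[a, +oo[]); last first.
    by apply/seteqP; split => w /=; rewrite in_itv/= andbT.
  rewrite -[X in measurable X]setTI.
  by apply: measurable_power_mean => //; exact: measurable_itv.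
apply: (@le_lt_trans _ _ (P E)).
  apply: le_measure; rewrite ?inE// => w /=; apply: contraTT.
  (* Off [E], the power mean is below [a] and the deterministic bound applies. *)
  rewrite -ltNge -leNgt => /ltW wa.
  apply: (le_trans (gap_le n _ n2)).
  apply: ler_wpM2r; first exact: powR_ge0.
  apply: ler_wpM2l => //.
  apply: lerXn2r; rewrite ?nnegrE ?(ltW a0)// (le_trans ler01)//.
  exact: power_mean_ge1.
rewrite -(@lte_pmul2l _ a%:E) ?lte_fin//.
apply: (le_lt_trans tail); rewrite -EFinM lte_fin divfK ?gt_eqF//; lra.
Qed.
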